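(* Let $\Gamma$ be a groupoid, let $D=\bigoplus_{\gamma\in\Gamma}D_\gamma$ be a $\Gamma$-graded division ring, let $\Gamma_0':=\Gamma_0'(D)$, and for $e,f\in\Gamma_0'$ write $e\sim f$ if and only if $1_eD1_f\neq0$. The following assertions hold: (1) $\sim$ is an equivalence relation on $\Gamma_0'$. (2) For each equivalence class $[e]\in\Gamma_0'/{\sim}$ define $\Gamma_{[e]}=\{\gamma\in\Gamma: d(\gamma),r(\gamma)\in[e]\}$ and $D_{[e]}=\bigoplus_{\gamma\in\Gamma_{[e]}}D_\gamma$. Then $D_{[e]}$ is a nonzero graded ideal of $D$, and $D_{[e]}D_{[f]}=\{0\}$ for $[e]\neq[f]$ in $\Gamma_0'/{\sim}$. (3) $D=\bigoplus_{[e]\in\Gamma_0'/\sim}D_{[e]}$, and $D_{[e]}$ is a gr-simple gr-division ring for each equivalence class $[e]\in\Gamma_0'/{\sim}$. (4) The following are equivalent: (a) $D$ is gr-simple; (b) $D$ is gr-prime; (c) $\Gamma_0'/{\sim}$ possesses only one equivalence class.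
   Context: A groupoid $\Gamma$ is a small category with all morphisms invertible, identified with its set of morphisms; $\Gamma_0$ is its set of objects (identified with identity morphisms). For $\gamma:e\to f$ write $d(\gamma)=e$, $r(\gamma)=f$; $\delta\gamma$ is defined iff $d(\delta)=r(\gamma)$. A $\Gamma$-graded ring is an associative ring $R=\bigoplus_{\gamma\in\Gamma}R_\gamma$ (additive subgroups) with $R_\gamma R_\delta\subseteq R_{\gamma\delta}$ if $\gamma\delta$ is defined and $R_\gamma R_\delta=0$ otherwise, assumed object unital: for each $e\in\Gamma_0$, $R_e$ is a unital ring with identity $1_e$ (possibly $1_e=0$) and $1_{r(\gamma)}a=a=a1_{d(\gamma)}$ for $a\in R_\gamma$. $R$ itself need not be unital. $\Gamma_0'(R)=\{e\in\Gamma_0:1_e\neq0\}$. A graded ideal is a two-sided ideal $I$ with $I=\bigoplus_\gamma(I\cap R_\gamma)$. $R$ is gr-simple if $R\neq0$ and its only graded ideals are $0$ and $R$; gr-prime if $IJ\ne0$ for all nonzero graded ideals $I,J$. A $\Gamma$-graded division ring (gr-division ring) is a $\Gamma$-graded ring $D\neq0$ such that each nonzero $a\in D_\gamma$ has an element $a^{-1}\in D_{\gamma^{-1}}$ with $aa^{-1}=1_{r(\gamma)}$ and $a^{-1}a=1_{d(\gamma)}$. *)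

(* Defs.v *)
From HB Require Import structures.
From mathcomp Require Import all_boot all_algebra.
From mathcomp Require Import boolp classical_sets.

Set Implicit Arguments.
Unset Strict Implicit.
Unset Printing Implicit Defensive.

Import GRing.Theory.
Local Open Scope classical_set_scope.
Local Open Scope ring_scope.

(* A groupoid is identified with its set of morphisms.  [gcomp h g] is the
   composite "h after g"; it is a total function, but every axiom constrains it
   only when [gdom h = gcod g], so its other values are irrelevant. *)
Record groupoid := Groupoid {
  gobj : Type;
  gmor :> choiceType;
  gdom : gmor -> gobj;
  gcod : gmor -> gobj;
  gid : gobj -> gmor;
  gcomp : gmor -> gmor -> gmor;
  ginv : gmor -> gmor;
  gdom_id : forall e, gdom (gid e) = e;
  gcod_id : forall e, gcod (gid e) = e;
  gdom_comp : forall h g, gdom h = gcod g -> gdom (gcomp h g) = gdom g;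
  gcod_comp : forall h g, gdom h = gcod g -> gcod (gcomp h g) = gcod h;
  gcompA : forall k h g, gdom k = gcod h -> gdom h = gcod g ->
    gcomp k (gcomp h g) = gcomp (gcomp k h) g;
  gcomp1g : forall g, gcomp (gid (gcod g)) g = g;
  gcompg1 : forall g, gcomp g (gid (gdom g)) = g;
  gdom_inv : forall g, gdom (ginv g) = gcod g;
  gcod_inv : forall g, gcod (ginv g) = gdom g;
  gcompVg : forall g, gcomp (ginv g) g = gid (gdom g);
  gcompgV : forall g, gcomp g (ginv g) = gid (gcod g)
}.

Definition additive_subgroup (M : zmodType) (A : set M) : Prop :=
  A 0 /\ forall x y, A x -> A y -> A (x - y).

Definition sumset (I : eqType) (M : zmodType) (P : set I) (A : I -> set M) :
    set M :=
  [set m | exists (s : seq I) (x : I -> M),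
     [/\ uniq s, forall i, i \in s -> P i /\ A i (x i)
       & m = \sum_(i <- s) x i]].

Definition independent (I : eqType) (M : zmodType) (P : set I)
    (A : I -> set M) : Prop :=
  forall (s : seq I) (x : I -> M),
    uniq s -> (forall i, i \in s -> P i /\ A i (x i)) ->
    \sum_(i <- s) x i = 0 -> forall i, i \in s -> x i = 0.

(* S is the internal direct sum of the A i, for i in P. *)
Definition is_direct_sum (I : eqType) (M : zmodType) (P : set I)
    (A : I -> set M) (S : set M) : Prop :=
  S = sumset P A /\ independent P A.

(* Object unital graded rings; the underlying ring need not have a unit, so it
   is a [zmodType] with an associative biadditive product. *)
Record graded_ring (G : groupoid) := GradedRing {
  gr_sort :> zmodType;
  gmul : gr_sort -> gr_sort -> gr_sort;
  gcmp : G -> set gr_sort;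
  gone : gobj G -> gr_sort;
  gmulA : associative gmul;
  gmulDl : left_distributive gmul +%R;
  gmulDr : right_distributive gmul +%R;
  gcmp_subgroup : forall g, additive_subgroup (gcmp g);
  gcmp_direct : is_direct_sum setT gcmp setT;
  gmul_cmp : forall g h x y, gdom g = gcod h -> gcmp g x -> gcmp h y ->
    gcmp (gcomp g h) (gmul x y);
  gmul_eq0 : forall g h x y, gdom g <> gcod h -> gcmp g x -> gcmp h y ->
    gmul x y = 0;
  gone_cmp : forall e, gcmp (gid e) (gone e);
  gone_mull : forall g x, gcmp g x -> gmul (gone (gcod g)) x = x;
  gone_mulr : forall g x, gcmp g x -> gmul x (gone (gdom g)) = x
}.

Definition ideal (G : groupoid) (R : graded_ring G) (I : set R) : Prop :=
  additive_subgroup I /\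
  forall r x, I x -> I (gmul r x) /\ I (gmul x r).

Definition graded_ideal (G : groupoid) (R : graded_ring G) (I : set R) : Prop :=
  ideal I /\ is_direct_sum setT (fun g : G => I `&` gcmp g) I.

(* The product of two additive subgroups: finite sums of products. *)
Definition set_prod (G : groupoid) (R : graded_ring G) (I J : set R) : set R :=
  [set m | exists s : seq (R * R),
     (forall p, p \in s -> I p.1 /\ J p.2) /\
     m = \sum_(p <- s) gmul p.1 p.2].

Definition gr_simple (G : groupoid) (R : graded_ring G) : Prop :=
  [set: R] <> [set 0] /\
  forall I : set R, graded_ideal I -> I = [set 0] \/ I = setT.

Definition gr_prime (G : groupoid) (R : graded_ring G) : Prop :=
  forall I J : set R, graded_ideal I -> graded_ideal J ->
    I <> [set 0] -> J <> [set 0] -> set_prod I J <> [set 0].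

Definition gr_division (G : groupoid) (D : graded_ring G) : Prop :=
  [set: D] <> [set 0] /\
  forall (g : G) (a : D), gcmp g a -> a <> 0 ->
    exists b : D, [/\ gcmp (ginv g) b, gmul a b = gone D (gcod g)
                    & gmul b a = gone D (gdom g)].

Definition objects' (G : groupoid) (R : graded_ring G) : set (gobj G) :=
  [set e | gone R e <> 0].

Definition linked (G : groupoid) (R : graded_ring G) (e f : gobj G) : Prop :=
  [set gmul (gmul (gone R e) x) (gone R f) | x in [set: R]] <> [set 0].

Definition equivalence_on (T : Type) (A : set T) (r : T -> T -> Prop) : Prop :=
  [/\ forall x, A x -> r x x,
      forall x y, A x -> A y -> r x y -> r y x
    & forall x y z, A x -> A y -> A z -> r x y -> r y z -> r x z].

Definition obj_class (G : groupoid) (R : graded_ring G) (e : gobj G) :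
    set (gobj G) :=
  [set f | objects' R f /\ linked R e f].

(* The quotient of [objects' R] by [linked R], as the set of classes. *)
Definition obj_classes (G : groupoid) (R : graded_ring G) :
    set (set (gobj G)) :=
  [set obj_class R e | e in objects' R].

Definition full_mor (G : groupoid) (X : set (gobj G)) : set G :=
  [set g | X (gdom g) /\ X (gcod g)].

Definition block (G : groupoid) (R : graded_ring G) (X : set (gobj G)) :
    set R :=
  sumset (full_mor X) (@gcmp G R).
Arguments block {G} R X.

Lemma sum_widen (I : eqType) (M : zmodType) (s u : seq I) (x : I -> M) :
  uniq s -> uniq u -> {subset s <= u} ->
  \sum_(i <- s) x i = \sum_(i <- u) (if i \in s then x i else 0).
Proof.
move=> us uu su; rewrite -big_mkcond -big_filter; apply: perm_big.
apply: uniq_perm => //; first exact: filter_uniq.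
by move=> i; rewrite mem_filter; case: (boolP (i \in s)) => // /su ->.
Qed.

Lemma sumset_subgroup (I : eqType) (M : zmodType) (P : set I)
    (A : I -> set M) :
  (forall i, additive_subgroup (A i)) -> additive_subgroup (sumset P A).
Proof.
move=> sgA; split; first by exists [::], (fun=> 0); rewrite big_nil.
move=> _ _ [s [x [us sx ->]]] [t [y [ut ty ->]]].
pose u := undup (s ++ t).
exists u, (fun i => (if i \in s then x i else 0) - (if i \in t then y i else 0)).
split; first exact: undup_uniq.
  move=> i; rewrite mem_undup mem_cat => ist.
  have [A0 AB] := sgA i; split.
    by case/orP: ist => [/sx[]|/ty[]].
  by apply: AB; case: ifP => //; [move=> /sx[]|move=> /ty[]].
rewrite sumrB; congr (_ - _); apply: sum_widen; rewrite ?undup_uniq //.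
  by move=> i si; rewrite mem_undup mem_cat si.
by move=> i ti; rewrite mem_undup mem_cat ti orbT.
Qed.

Lemma subgroup_add (M : zmodType) (A : set M) (x y : M) :
  additive_subgroup A -> A x -> A y -> A (x + y).
Proof.
move=> [A0 AB] Ax Ay; rewrite -[y]opprK; apply: (AB) => //.
by rewrite -sub0r; apply: AB.
Qed.

Lemma subgroup_sum (I : eqType) (M : zmodType) (A : set M) (s : seq I)
    (x : I -> M) :
  additive_subgroup A -> (forall i, i \in s -> A (x i)) ->
  A (\sum_(i <- s) x i).
Proof.
move=> sgA sx; rewrite big_seq; elim/big_ind: _ => //; first by case: sgA.
by move=> *; apply: subgroup_add.
Qed.

Lemma gmul0l (G : groupoid) (R : graded_ring G) (y : R) : gmul 0 y = 0.
Proof. by apply: (@addrI _ (gmul 0 y)); rewrite -gmulDl !addr0. Qed.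

Lemma gmul0r (G : groupoid) (R : graded_ring G) (y : R) : gmul y 0 = 0.
Proof. by apply: (@addrI _ (gmul y 0)); rewrite -gmulDr !addr0. Qed.

Lemma gmul_suml (G : groupoid) (R : graded_ring G) (I : Type) (s : seq I)
    (x : I -> R) (y : R) :
  gmul (\sum_(i <- s) x i) y = \sum_(i <- s) gmul (x i) y.
Proof.
elim: s => [|i s IHs]; first by rewrite !big_nil gmul0l.
by rewrite !big_cons gmulDl IHs.
Qed.

Lemma gmul_sumr (G : groupoid) (R : graded_ring G) (I : Type) (s : seq I)
    (x : I -> R) (y : R) :
  gmul y (\sum_(i <- s) x i) = \sum_(i <- s) gmul y (x i).
Proof.
elim: s => [|i s IHs]; first by rewrite !big_nil gmul0r.
by rewrite !big_cons gmulDr IHs.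
Qed.

Lemma block_subgroup (G : groupoid) (R : graded_ring G) (X : set (gobj G)) :
  additive_subgroup (block R X).
Proof. by apply: sumset_subgroup => g; apply: gcmp_subgroup. Qed.

Lemma cmp_block (G : groupoid) (R : graded_ring G) (X : set (gobj G)) (g : G)
    (x : R) : full_mor X g -> gcmp g x -> block R X x.
Proof.
move=> Xg gx; exists [:: g], (fun=> x); split; rewrite ?big_seq1 //.
by move=> i; rewrite inE => /eqP ->.
Qed.

Lemma block_mul (G : groupoid) (R : graded_ring G) (X : set (gobj G))
    (x y : R) : block R X x -> block R X y -> block R X (gmul x y).
Proof.
move=> [s [a [_ sa ->]]] [t [b [_ tb ->]]].
have sgX := block_subgroup R X.
rewrite gmul_suml; apply: (subgroup_sum sgX) => g /sa[[Xg Xg'] ga].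
rewrite gmul_sumr; apply: (subgroup_sum sgX) => h /tb[[Xh Xh'] hb].
have [gh|gh] := pselect (gdom g = gcod h).
  apply: (cmp_block _ (gmul_cmp gh ga hb)).
  by split; rewrite ?gdom_comp ?gcod_comp.
by rewrite (gmul_eq0 gh ga hb); case: sgX.
Qed.

Lemma block_cmp_eq0 (G : groupoid) (R : graded_ring G) (X : set (gobj G))
    (g : G) (x : R) : ~ full_mor X g -> gcmp g x -> block R X x -> x = 0.
Proof.
move=> nXg gx [s [a [us sa xE]]].
have gs : g \notin s by apply/negP => /sa[].
have [_ ind] := gcmp_direct R.
have [A0 AB] := gcmp_subgroup R g.
have sne i : i \in s -> (i == g) = false.
  by move=> si; apply/negbTE; apply: contraNneq gs => <-.
pose z i := if i == g then - x else a i.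
have zg : z g = - x by rewrite /z eqxx.
have : z g = 0.
  apply: (ind (g :: s)); rewrite /= ?gs ?mem_head //.
    move=> i; rewrite inE /z; case: eqP => [-> _|_ /= /sa[]//].
    by split=> //; rewrite -sub0r; apply: AB.
  rewrite big_cons zg xE addrC; apply/eqP; rewrite subr_eq0; apply/eqP.
  by apply: eq_big_seq => i /sne; rewrite /z => ->.
by rewrite zg => /eqP; rewrite oppr_eq0 => /eqP.
Qed.

Definition block_pred (G : groupoid) (R : graded_ring G) (X : set (gobj G)) :
    {pred R} :=
  fun x => x \in block R X.

Lemma block_predP (G : groupoid) (R : graded_ring G) (X : set (gobj G))
    (x : R) : (x \in block_pred X) <-> block R X x.
Proof. by split=> [/set_mem|/mem_set]. Qed.

Lemma block_zmod_closed (G : groupoid) (R : graded_ring G)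
    (X : set (gobj G)) : zmod_closed (@block_pred G R X).
Proof.
have [A0 AB] := block_subgroup R X.
split; first exact/block_predP.
by move=> x y /block_predP Xx /block_predP Xy; apply/block_predP/AB.
Qed.

HB.instance Definition _ (G : groupoid) (R : graded_ring G)
    (X : set (gobj G)) :=
  GRing.isZmodClosed.Build R (@block_pred G R X) (block_zmod_closed R X).

Record block_type (G : groupoid) (R : graded_ring G) (X : set (gobj G)) :=
  BlockType { block_val :> R; _ : block_val \in block_pred X }.
Arguments block_type {G} R X.

HB.instance Definition _ (G : groupoid) (R : graded_ring G)
  (X : set (gobj G)) := [isSub for @block_val G R X].
HB.instance Definition _ (G : groupoid) (R : graded_ring G)
  (X : set (gobj G)) := [Choice of block_type R X by <:].
HB.instance Definition _ (G : groupoid) (R : graded_ring G)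
  (X : set (gobj G)) := [SubChoice_isSubZmodule of block_type R X by <:].

Lemma block_valP (G : groupoid) (R : graded_ring G) (X : set (gobj G))
    (x : block_type R X) : block R X (val x).
Proof. exact/block_predP/valP. Qed.

Definition block_mulr (G : groupoid) (R : graded_ring G) (X : set (gobj G))
    (x y : block_type R X) : block_type R X :=
  BlockType
    (proj2 (block_predP _ _) (block_mul (block_valP x) (block_valP y))).

Definition block_gcmp (G : groupoid) (R : graded_ring G) (X : set (gobj G))
    (g : G) : set (block_type R X) :=
  [set x | gcmp g (val x)].

(* This is 1_e if e is in X, and 0 otherwise. *)
Definition block_one (G : groupoid) (R : graded_ring G) (X : set (gobj G))
    (e : gobj G) : block_type R X :=
  insubd (0 : block_type R X) (gone R e).

Lemma val_block_one (G : groupoid) (R : graded_ring G) (X : set (gobj G))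
    (e : gobj G) : X e -> val (block_one R X e) = gone R e.
Proof.
move=> Xe; rewrite insubdK //; apply/block_predP.
by apply: (cmp_block _ (gone_cmp R e)); split; rewrite ?gdom_id ?gcod_id.
Qed.

Lemma block_one0 (G : groupoid) (R : graded_ring G) (X : set (gobj G))
    (e : gobj G) : ~ X e -> block_one R X e = 0.
Proof.
move=> nXe; apply: val_inj; rewrite val_insubd.
case: ifP => // /block_predP; apply: block_cmp_eq0 (gone_cmp R e).
by rewrite /full_mor /= gdom_id => -[].
Qed.

Lemma block_mulrA (G : groupoid) (R : graded_ring G) (X : set (gobj G)) :
  associative (@block_mulr G R X).
Proof. by move=> x y z; apply: val_inj; apply: gmulA. Qed.

Lemma block_mulrDl (G : groupoid) (R : graded_ring G) (X : set (gobj G)) :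
  left_distributive (@block_mulr G R X) +%R.
Proof. by move=> x y z; apply: val_inj; apply: gmulDl. Qed.

Lemma block_mulrDr (G : groupoid) (R : graded_ring G) (X : set (gobj G)) :
  right_distributive (@block_mulr G R X) +%R.
Proof. by move=> x y z; apply: val_inj; apply: gmulDr. Qed.

Lemma block_gcmp_subgroup (G : groupoid) (R : graded_ring G)
    (X : set (gobj G)) (g : G) : additive_subgroup (@block_gcmp G R X g).
Proof.
have [A0 AB] := gcmp_subgroup R g; split; first exact: A0.
by move=> x y gx gy; apply: AB.
Qed.

Lemma block_gcmp_direct (G : groupoid) (R : graded_ring G)
    (X : set (gobj G)) : is_direct_sum setT (@block_gcmp G R X) setT.
Proof.
split; last first.
  move=> s x us sx x0 i si; apply: val_inj.
  have [_ ind] := gcmp_direct R.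
  apply: (ind s (fun i => val (x i))) => //.
  by rewrite -raddf_sum x0.
apply/seteqP; split=> x _ //.
have [s [a [us sa xE]]] := block_valP x.
have valK i : i \in s -> val (insubd (0 : block_type R X) (a i)) = a i.
  by move=> /sa[Xi ia]; rewrite insubdK //; apply/block_predP/(cmp_block Xi).
exists s, (fun i => insubd 0 (a i)); split=> //.
  by move=> i si; split=> //; rewrite /block_gcmp /= valK //; case/sa: si.
apply: val_inj; rewrite xE raddf_sum; apply: eq_big_seq => i si.
by rewrite /= valK.
Qed.

Lemma block_gmul_cmp (G : groupoid) (R : graded_ring G) (X : set (gobj G))
    (g h : G) (x y : block_type R X) :
  gdom g = gcod h -> block_gcmp g x -> block_gcmp h y ->
  block_gcmp (gcomp g h) (block_mulr x y).
Proof. exact: gmul_cmp. Qed.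

Lemma block_gmul_eq0 (G : groupoid) (R : graded_ring G) (X : set (gobj G))
    (g h : G) (x y : block_type R X) :
  gdom g <> gcod h -> block_gcmp g x -> block_gcmp h y -> block_mulr x y = 0.
Proof. by move=> gh gx hy; apply: val_inj; apply: (gmul_eq0 gh). Qed.

Lemma block_gone_cmp (G : groupoid) (R : graded_ring G) (X : set (gobj G))
    (e : gobj G) : block_gcmp (gid e) (block_one R X e).
Proof.
have [Xe|nXe] := pselect (X e); last first.
  by rewrite block_one0 //; case: (block_gcmp_subgroup R X (gid e)).
by rewrite /block_gcmp /= val_block_one //; apply: gone_cmp.
Qed.

Lemma block_gone_mull (G : groupoid) (R : graded_ring G) (X : set (gobj G))
    (g : G) (x : block_type R X) :
  block_gcmp g x -> block_mulr (block_one R X (gcod g)) x = x.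
Proof.
move=> gx; apply: val_inj => /=.
have [Xg|nXg] := pselect (X (gcod g)).
  by rewrite [block_val (block_one _ _ _)]val_block_one //; apply: gone_mull.
rewrite (_ : block_val x = 0) ?gmul0r //.
by apply: (@block_cmp_eq0 _ _ X g) (block_valP x) => // -[].
Qed.

Lemma block_gone_mulr (G : groupoid) (R : graded_ring G) (X : set (gobj G))
    (g : G) (x : block_type R X) :
  block_gcmp g x -> block_mulr x (block_one R X (gdom g)) = x.
Proof.
move=> gx; apply: val_inj => /=.
have [Xg|nXg] := pselect (X (gdom g)).
  by rewrite [block_val (block_one _ _ _)]val_block_one //; apply: gone_mulr.
rewrite (_ : block_val x = 0) ?gmul0l //.
by apply: (@block_cmp_eq0 _ _ X g) (block_valP x) => // -[].
Qed.

(* [block R X] as a graded ring in its own right, with the product of R and the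
   components R_g for g in [full_mor X]; by [block_cmp_eq0], its other
   components vanish. *)
Definition block_ring (G : groupoid) (R : graded_ring G) (X : set (gobj G)) :
    graded_ring G :=
  GradedRing (@block_mulrA G R X) (@block_mulrDl G R X) (@block_mulrDr G R X)
    (@block_gcmp_subgroup G R X) (@block_gcmp_direct G R X)
    (@block_gmul_cmp G R X) (@block_gmul_eq0 G R X) (@block_gone_cmp G R X)
    (@block_gone_mull G R X) (@block_gone_mulr G R X).

(* Main.v *)
Require Import Defs.
From mathcomp Require Import all_boot all_algebra.
From mathcomp Require Import boolp classical_sets.

(** Call a morphism supported when its component contains a nonzero element.
    The whole statement is about the supported morphisms: [e] and [f] are linked
    exactly when some supported morphism goes from [f] to [e] ([linkedP]).

    In a gr-division ring nonzero homogeneous elements are invertible, so the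
    supported morphisms form a subgroupoid: identities at the objects with
    [1_e <> 0], inverses ([supported_inv]) and composites ([supported_comp]).
    Being connected in a groupoid is an equivalence relation, which is (1), and
    a class contains one end of a supported morphism as soon as it contains the
    other ([class_saturated]).  Each nonzero component of the ring therefore
    lies in exactly one block, and homogeneous elements of distinct blocks are
    never composable.  This gives the ideals, the zero products and the
    decomposition; independence of the blocks is seen by multiplying a vanishing
    sum by the local units [1_e], since [1_e] kills every block but its own and
    the local units together detect every element ([block_eq0]).

    For simplicity, a nonzero graded ideal contains a nonzero homogeneous
    element, hence some [1_e]; if [y] is nonzero and homogeneous between [e] and
    [f] then [1_f] is the product of [y], [1_e] and the inverse of [y], so the
    ideal contains all the local units and is everything.  Thus a gr-division
    ring whose nonzero objects are pairwise linked is gr-simple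
    ([gr_simple_of_linked]).  This applies both to each block and, in (4), to the
    ring itself when there is a single class; conversely, two distinct classes
    provide two nonzero graded ideals whose product is zero. *)

Set Implicit Arguments.
Unset Strict Implicit.
Unset Printing Implicit Defensive.

Import GRing.Theory.
Local Open Scope classical_set_scope.
Local Open Scope ring_scope.

(** * Additive subgroups and sums of subsets *)

Lemma neq_set0P (M : zmodType) (A : set M) :
  A 0 -> A <> [set 0] <-> exists2 x, A x & x <> 0.
Proof.
move=> A0; split=> [nA|[x Ax x0] A_eq]; last by apply: x0; move: Ax; rewrite A_eq.
apply: contrapT => nex; apply: nA; apply/seteqP; split=> [x Ax|x ->//].
by apply: contrapT => x0; apply: nex; exists x.
Qed.

Lemma sumset_neq0 (I : eqType) (M : zmodType) (P : set I) (A : I -> set M) x :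
  sumset P A x -> x <> 0 -> exists i y, [/\ P i, A i y & y <> 0].
Proof.
move=> [s [a [_ sa ->]]] a0; apply: contrapT => nex; apply: a0.
apply: big1_seq => i /andP[_ /sa[Pi Ai]].
by apply: contrapT => ai; apply: nex; exists i, (a i).
Qed.

Lemma sub_sumset (I : eqType) (M : zmodType) (P : set I) (A : I -> set M) i :
  P i -> A i `<=` sumset P A.
Proof.
move=> Pi x Ax; exists [:: i], (fun=> x); split; rewrite ?big_seq1 //.
by move=> j; rewrite inE => /eqP ->.
Qed.

(** * Homogeneous elements, linked objects and local units *)

Section GradedRing.
Variables (G : groupoid) (R : graded_ring G).
Implicit Types (e f : gobj G) (g h : G) (x y : R) (X : set (gobj G)).

Definition supported g := exists2 x : R, gcmp g x & x <> 0.

Lemma gcmp0 g : gcmp g (0 : R).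
Proof. by case: (gcmp_subgroup R g). Qed.

Lemma sum_components x : sumset setT (@gcmp G R) x.
Proof. by have [<- _] := gcmp_direct R. Qed.

Lemma gone_neq_mull e g x : gcmp g x -> e <> gcod g -> gmul (gone R e) x = 0.
Proof. by move=> gx eg; apply: (gmul_eq0 _ (gone_cmp R e) gx); rewrite gdom_id. Qed.

Lemma gone_neq_mulr e g x : gcmp g x -> e <> gdom g -> gmul x (gone R e) = 0.
Proof.
move=> gx eg; apply: (gmul_eq0 _ gx (gone_cmp R e)); rewrite gcod_id.
by move=> ge; apply: eg.
Qed.

Lemma supported_cod g : supported g -> objects' R (gcod g).
Proof. by move=> [x gx x0] c0; apply: x0; rewrite -(gone_mull gx) c0 gmul0l. Qed.

Lemma supported_dom g : supported g -> objects' R (gdom g).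
Proof. by move=> [x gx x0] d0; apply: x0; rewrite -(gone_mulr gx) d0 gmul0r. Qed.

Lemma supported_id e : objects' R e -> supported (gid e).
Proof. by move=> e0; exists (gone R e) => //; apply: gone_cmp. Qed.

(** Multiplying by [1_e] and [1_f] on the two sides selects the components
    indexed by the morphisms from [f] to [e]. *)
Lemma linkedP e f :
  linked R e f <-> exists2 g, supported g & gcod g = e /\ gdom g = f.
Proof.
have z e' f' : [set gmul (gmul (gone R e') x) (gone R f') | x in [set: R]] 0.
  by exists 0 => //; rewrite gmul0r gmul0l.
split=> [/(neq_set0P (z e f))[_ [x _ <-]] nz|[g [x gx x0] [<- <-]]]; last first.
  apply/(neq_set0P (z _ _)); exists x => //; exists x => //.
  by rewrite (gone_mull gx) (gone_mulr gx).
have [s [a [_ sa xE]]] := sum_components x.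
apply: contrapT => nex; apply: nz; rewrite xE gmul_sumr gmul_suml.
apply: big1_seq => g /andP[_ /sa[_ ga]].
have [eg|eg] := pselect (e = gcod g); last by rewrite (gone_neq_mull ga eg) gmul0l.
rewrite eg (gone_mull ga).
have [fg|fg] := pselect (f = gdom g); last exact: gone_neq_mulr ga fg.
rewrite fg (gone_mulr ga); apply: contrapT => ag.
by apply: nex; exists g => //; exists (a g).
Qed.

(** The components of an ideal are independent because those of [R] are, so a
    graded ideal is recognised by the homogeneous decompositions alone. *)
Lemma graded_idealP (I : set R) : ideal I ->
  I `<=` sumset setT (fun g => I `&` gcmp g) -> graded_ideal I.
Proof.
move=> idI sI; split=> //; split.
  apply/seteqP; split=> // _ [s [a [_ sa ->]]].
  by apply: (subgroup_sum (proj1 idI)) => g /sa[_ []].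
have [_ ind] := gcmp_direct R.
by move=> s a us sa; apply: ind us _ => g /sa[_ []].
Qed.

(** Multiplying [x] by [1_e] keeps its components with codomain [e] and kills
    the others, so the products [1_e x] recover all the components of [x]. *)
Lemma block_eq0 X x :
  block R X x -> (forall e, X e -> gmul (gone R e) x = 0) -> x = 0.
Proof.
move=> [s [a [us sa ->]]] kill; have [_ ind] := gcmp_direct R.
apply: big1_seq => g /andP[_ gs]; have [[_ Xg] ga] := sa g gs.
rewrite -(gone_mull ga).
apply: (ind s (fun h => gmul (gone R (gcod g)) (a h)) us) => //.
  move=> h /sa[_ ha]; split=> //.
  have [gh|gh] := pselect (gcod g = gcod h); first by rewrite gh (gone_mull ha).
  by rewrite (gone_neq_mull ha gh); apply: gcmp0.
by rewrite -gmul_sumr kill.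
Qed.

Lemma block_mul_disjoint X Y x y : X `&` Y = set0 ->
  block R X x -> block R Y y -> gmul x y = 0.
Proof.
move=> XY [s [a [_ sa ->]]] [t [b [_ tb ->]]].
rewrite gmul_suml; apply: big1_seq => g /andP[_ /sa[[Xg _] ga]].
rewrite gmul_sumr; apply: big1_seq => h /andP[_ /tb[[_ Yh] hb]].
apply: (gmul_eq0 _ ga hb) => gh.
have : (X `&` Y) (gdom g) by split=> //; rewrite gh.
by rewrite XY.
Qed.

Lemma block_gone X e : X e -> block R X (gone R e).
Proof.
move=> Xe; apply: (cmp_block _ (gone_cmp R e)).
by split; rewrite ?gdom_id ?gcod_id.
Qed.

(** * Graded ideals from saturated sets of objects *)

Definition saturated X :=
  forall g, supported g -> X (gdom g) <-> X (gcod g).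

(** Saturation is exactly what keeps a product in the block when only one of
    its two factors lies there: the remaining end of the other factor, if that
    factor is nonzero, is forced into [X]. *)
Lemma block_ideal X : saturated X -> ideal (block R X).
Proof.
move=> satX; have sgX := block_subgroup R X; split=> // r x.
have [s [a [_ sa ->]]] := sum_components r.
move=> [t [b [_ tb ->]]]; split.
  rewrite gmul_suml; apply: (subgroup_sum sgX) => g /sa[_ ga].
  rewrite gmul_sumr; apply: (subgroup_sum sgX) => h /tb[[Xd Xc] hb].
  have [gh|gh] := pselect (gdom g = gcod h); last first.
    by rewrite (gmul_eq0 gh ga hb); case: sgX.
  have [->|ag] := pselect (a g = 0); first by rewrite gmul0l; case: sgX.
  apply: (cmp_block _ (gmul_cmp gh ga hb)).
  split; rewrite ?gdom_comp ?gcod_comp //.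
  by apply/(satX g); [exists (a g)|rewrite gh].
rewrite gmul_suml; apply: (subgroup_sum sgX) => g /tb[[Xd Xc] ga].
rewrite gmul_sumr; apply: (subgroup_sum sgX) => h /sa[_ hb].
have [gh|gh] := pselect (gdom g = gcod h); last first.
  by rewrite (gmul_eq0 gh ga hb); case: sgX.
have [->|ah] := pselect (a h = 0); first by rewrite gmul0r; case: sgX.
apply: (cmp_block _ (gmul_cmp gh ga hb)).
split; rewrite ?gdom_comp ?gcod_comp //.
by apply/(satX h); [exists (a h)|rewrite -gh].
Qed.

Lemma block_graded_ideal X : saturated X -> graded_ideal (block R X).
Proof.
move=> satX; apply: graded_idealP; first exact: block_ideal.
move=> _ [s [a [us sa ->]]]; exists s, a; split=> // g /sa[Xg ga].
by split=> //; split=> //; apply: (cmp_block Xg).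
Qed.

Lemma block_neq0 X e : X e -> objects' R e -> block R X <> [set 0].
Proof.
move=> Xe e0; apply/neq_set0P; first by case: (block_subgroup R X).
by exists (gone R e) => //; apply: block_gone.
Qed.

Lemma exists_supported : [set: R] <> [set 0] -> exists g, supported g.
Proof.
move=> /(neq_set0P (A := [set: R]) I)[x _ x0].
by have [g [y [_ gy y0]]] := sumset_neq0 (sum_components x) x0; exists g, y.
Qed.

Lemma gr_simple_prime : gr_simple R -> gr_prime R.
Proof.
move=> [R0 simR] I J gI gJ I0 J0.
have [//|->] := simR I gI; have [//|->] := simR J gJ.
have [g /supported_cod e0] := exists_supported R0.
apply/neq_set0P; first by exists [::]; rewrite big_nil.
exists (gone R (gcod g)) => //.
exists [:: (gone R (gcod g), gone R (gcod g))]; split=> //.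
rewrite big_seq1 /=.
by have := gone_mull (gone_cmp R (gcod g)); rewrite gcod_id => ->.
Qed.

End GradedRing.

Arguments supported {G} R g.
Arguments saturated {G} R X.

(** * Gr-division rings *)

Section GradedDivision.
Variables (G : groupoid) (D : graded_ring G) (hD : gr_division D).
Implicit Types (e f : gobj G) (g h : G) (X C : set (gobj G)).

Lemma supported_inv g : supported D g -> supported D (ginv g).
Proof.
move=> sg; have [a ga a0] := sg.
have [b [gb ab _]] := proj2 hD g a ga a0.
exists b => // b0; apply: (supported_cod sg).
by rewrite -ab b0 gmul0r.
Qed.

(** A left inverse of the first factor recovers the second one from the
    product, which therefore cannot vanish. *)
Lemma supported_comp g h : gdom g = gcod h ->
  supported D g -> supported D h -> supported D (gcomp g h).
Proof.
move=> gh [a ga a0] [c hc c0].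
have [b [_ _ ba]] := proj2 hD g a ga a0.
exists (gmul a c); first exact: gmul_cmp.
by move=> ac; apply: c0; rewrite -(gone_mull hc) -gh -ba -gmulA ac gmul0r.
Qed.

Lemma linked_sym e f : linked D e f -> linked D f e.
Proof.
move=> /linkedP[g sg [<- <-]]; apply/linkedP; exists (ginv g).
  exact: supported_inv.
by rewrite gcod_inv gdom_inv.
Qed.

Lemma linked_trans e f k : linked D e f -> linked D f k -> linked D e k.
Proof.
move=> /linkedP[g sg [<- gf]] /linkedP[h sh [hf <-]]; apply/linkedP.
have gh : gdom g = gcod h by rewrite gf hf.
exists (gcomp g h); first exact: supported_comp.
by rewrite gcod_comp // gdom_comp.
Qed.

Lemma linked_refl e : objects' D e -> linked D e e.
Proof.
move=> e0; apply/linkedP; exists (gid e); first exact: supported_id.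
by rewrite gcod_id gdom_id.
Qed.

Lemma obj_class_refl e : objects' D e -> obj_class D e e.
Proof. by move=> e0; split=> //; apply: linked_refl. Qed.

Lemma obj_class_eq e f : linked D e f -> obj_class D e = obj_class D f.
Proof.
move=> ef; apply/seteqP; split=> k [k0 kl]; split=> //.
  exact: linked_trans (linked_sym ef) kl.
exact: linked_trans ef kl.
Qed.

Lemma obj_classesE C e : obj_classes D C -> C e -> C = obj_class D e.
Proof. by move=> [f _ <-] [_ fe]; apply: obj_class_eq. Qed.

Lemma obj_classes_disjoint C C' : obj_classes D C -> obj_classes D C' ->
  C <> C' -> C `&` C' = set0.
Proof.
move=> cC cC' CC'; apply/seteqP; split=> // e [Ce C'e]; apply: CC'.
by rewrite (obj_classesE cC Ce) (obj_classesE cC' C'e).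
Qed.

Lemma class_saturated C : obj_classes D C -> saturated D C.
Proof.
move=> [e _ <-] g sg.
have cd : linked D (gcod g) (gdom g) by apply/linkedP; exists g.
split=> -[_ eg]; split.
- exact: supported_cod.
- exact: linked_trans eg (linked_sym cd).
- exact: supported_dom.
- exact: linked_trans eg cd.
Qed.

Lemma obj_classes_neq0 C : obj_classes D C -> exists2 e, C e & objects' D e.
Proof. by move=> [e e0 <-]; exists e => //; apply: obj_class_refl. Qed.

Lemma blocks_direct_sum :
  is_direct_sum (obj_classes D) (block D) [set: D].
Proof.
split.
  apply/seteqP; split=> // x _; have [s [a [_ sa ->]]] := sum_components x.
  have sg := sumset_subgroup (obj_classes D) (block_subgroup D).
  apply: (subgroup_sum sg) => g /sa[_ ga].
  have [->|a0] := pselect (a g = 0); first by case: sg.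
  have sg' : supported D g by exists (a g).
  have c0 := supported_cod sg'.
  have cC : obj_classes D (obj_class D (gcod g)) by exists (gcod g).
  apply: (sub_sumset cC); apply: cmp_block ga.
  by split; [apply/(class_saturated cC sg')|]; apply: obj_class_refl.
(* Multiplying the sum by [1_e] for [e] in [C] leaves only its [C] term. *)
move=> s x us sx sum0 C Cs; have [cC xC] := sx C Cs.
apply: (block_eq0 xC) => e Ce.
have := congr1 (gmul (gone D e)) sum0.
rewrite gmul_sumr gmul0r (bigD1_seq C) //= big1_seq ?addr0 // => C' /andP[C'C C's].
have [cC' xC'] := sx C' C's.
apply: block_mul_disjoint (block_gone D Ce) xC'.
by apply: obj_classes_disjoint => // CC'; rewrite CC' eqxx in C'C.
Qed.

(** Invertibility turns one nonzero homogeneous element of the ideal into a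
    local unit, links carry this unit to all the other nonzero objects, and the
    local units generate everything. *)
Lemma gr_simple_of_linked :
  (forall e f, objects' D e -> objects' D f -> linked D e f) -> gr_simple D.
Proof.
move=> lk; split=> [|I [[sgI idI] [IE _]]]; first by case: hD.
have [->|I0] := pselect (I = [set 0]); [by left|right].
have [x Ix x0] : exists2 x, I x & x <> 0.
  by apply/neq_set0P => //; case: sgI.
rewrite IE in Ix.
have [g [a [_ [Ia ga] a0]]] := sumset_neq0 Ix x0.
have [b [_ _ ba]] := proj2 hD g a ga a0.
have Ie : I (gone D (gdom g)) by rewrite -ba; case: (idI b a Ia).
have e0 : objects' D (gdom g) by apply: supported_dom; exists a.
have Iunit f : objects' D f -> I (gone D f).
  move=> f0; have /linkedP[h [y hy y0] [<- hg]] := lk f (gdom g) f0 e0.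
  have [z [_ yz _]] := proj2 hD h y hy y0.
  (* 1_f = y 1_e y^-1 *)
  rewrite -yz -(gone_mulr hy) hg.
  by have [Iy _] := idI y _ Ie; case: (idI z _ Iy).
apply/seteqP; split=> // r _; have [s [c [_ sc ->]]] := sum_components r.
apply: (subgroup_sum sgI) => h /sc[_ hc].
have [->|c0] := pselect (c h = 0); first by case: sgI.
have o : objects' D (gcod h) by apply: supported_cod; exists (c h).
by rewrite -(gone_mull hc); case: (idI (c h) _ (Iunit _ o)).
Qed.

(** The inverse of an element of degree [g] has degree [ginv g], whose ends are
    those of [g], so it stays in the block. *)
Lemma block_gr_division X e : X e -> objects' D e -> gr_division (block_ring D X).
Proof.
move=> Xe e0; split.
  apply/neq_set0P => //; exists (block_one D X e) => // o0.
  by apply: e0; rewrite -(val_block_one D Xe) o0.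
move=> g a ga a0.
have va0 : val a <> 0 by move=> v0; apply: a0; apply: val_inj.
have [Xd Xc] : full_mor X g.
  apply: contrapT => nX; apply: va0.
  exact: (@block_cmp_eq0 _ D X g _ nX ga (block_valP a)).
have [b [gb ab ba]] := proj2 hD g (val a) ga va0.
have Xb : b \in block_pred X.
  apply/block_predP; apply: (cmp_block _ gb).
  by split; rewrite ?gdom_inv ?gcod_inv.
by exists (BlockType Xb); split=> //; apply: val_inj; rewrite val_block_one.
Qed.

(** A nonzero element witnessing a link between two objects of the class lies in
    the block itself, so no link is lost when passing to the block ring. *)
Lemma class_block_linked C e f : obj_classes D C ->
  objects' (block_ring D C) e -> objects' (block_ring D C) f ->
  linked (block_ring D C) e f.
Proof.
move=> cC e0 f0.
have inC k : objects' (block_ring D C) k -> C k.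
  by move=> k0; apply: contrapT => nC; apply: k0; apply: block_one0.
have Ce := inC e e0; have Cf := inC f f0.
have [_ /linkedP[g [y gy y0] [ge gf]]] : obj_class D e f.
  by rewrite -(obj_classesE cC Ce).
have Xy : y \in block_pred C.
  by apply/block_predP; apply: (cmp_block _ gy); split; rewrite ?ge ?gf.
apply/linkedP; exists g => //; exists (BlockType Xy) => //.
by move=> /(congr1 val).
Qed.

End GradedDivision.

Theorem proposition4p1 (G : groupoid) (D : graded_ring G)
    (hD : gr_division D) :
  [/\ equivalence_on (objects' D) (linked D),
      (forall C, obj_classes D C ->
         graded_ideal (block D C) /\ block D C <> [set 0]) /\
      (forall C C', obj_classes D C -> obj_classes D C' -> C <> C' ->
         set_prod (block D C) (block D C') = [set 0]),
      is_direct_sum (obj_classes D) (block D) [set: D] /\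
      (forall C, obj_classes D C ->
         gr_simple (block_ring D C) /\ gr_division (block_ring D C))
    & [<-> gr_simple D; gr_prime D; exists! C, obj_classes D C]].
Proof.
have graded_blocks C : obj_classes D C ->
    graded_ideal (block D C) /\ block D C <> [set 0].
  move=> cC; split; first exact: block_graded_ideal (class_saturated hD cC).
  by have [e Ce e0] := obj_classes_neq0 cC; apply: block_neq0 Ce e0.
have prod_blocks C C' : obj_classes D C -> obj_classes D C' -> C <> C' ->
    set_prod (block D C) (block D C') = [set 0].
  move=> cC cC' CC'; have dis := obj_classes_disjoint hD cC cC' CC'.
  apply/seteqP; split=> [_ [s [sI ->]]|_ ->]; last first.
    by exists [::]; rewrite big_nil.
  apply: big1_seq => p /andP[_ /sI[p1 p2]].
  exact: block_mul_disjoint dis p1 p2.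
split; [|by []| |].
- split=> [e|e f _ _|e f k _ _ _].
  + exact: linked_refl.
  + exact: linked_sym.
  + exact: linked_trans.
- split=> [|C cC]; first exact: blocks_direct_sum.
  have [e Ce e0] := obj_classes_neq0 cC.
  have divC := block_gr_division hD Ce e0; split=> //.
  by apply: (gr_simple_of_linked divC) => k f; apply: class_block_linked.
tfae.
- exact: gr_simple_prime.
- move=> primeD; have [g /supported_cod e0] := exists_supported (proj1 hD).
  exists (obj_class D (gcod g)); split; first by exists (gcod g).
  move=> C cC; apply: contrapT => neC.
  have cE : obj_classes D (obj_class D (gcod g)) by exists (gcod g).
  have [[gE E0] [gC C0]] := (graded_blocks _ cE, graded_blocks _ cC).
  exact: (primeD _ _ gE gC E0 C0 (prod_blocks _ _ cE cC neC)).
- move=> [C [_ uC]]; apply: gr_simple_of_linked hD _ => e f e0 f0.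
  have [_ //] : obj_class D e f.
  rewrite -(uC (obj_class D e)); last by exists e.
  rewrite (uC (obj_class D f)); last by exists f.
  exact: obj_class_refl.
Qed.
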